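(* Let $M\in\mathbb{R}^{m\times n}$ with $m\ge n$, let $1\le k\le r\le m$, $k\le n$, $k<m$, and suppose $C_k(M)\ne 0$ (so that volume sampling is well defined). Let $(I,J)\in\mathcal{S}_r(m)\times\mathcal{S}_k(n)$ be drawn by volume sampling and let $\mathsf{CUR}=M_{:,J}M_{I,J}^+M_{I,:}$. Then $$\mathbb{E}\left(\|\mathsf{CUR}-M\|_F^2\right)\le\left(\frac{m-r}{m-k}(k+1)^2+\frac{r-k}{m-k}(k+1)\right)\frac{\|C_{k+1}(M)\|_F^2}{\|C_k(M)\|_F^2}.$$
   Context: $\mathcal{S}_q(N)$ denotes the set of all $q$-element subsets of $\{1,\dots,N\}$. For $I\in\mathcal{S}_r(m)$ and $J\in\mathcal{S}_k(n)$, $M_{I,J}$ is the submatrix of $M$ with rows indexed by $I$ and columns indexed by $J$; $M_{:,J}$ consists of the columns of $M$ indexed by $J$ and $M_{I,:}$ of the rows indexed by $I$. $A^+$ is the Moore–Penrose pseudoinverse and $\|\cdot\|_F$ the Frobenius norm. $C_q(M)$ is the $q$-th compound matrix of $M$, the $\binom{m}{q}\times\binom{n}{q}$ matrix whose entries are the minors $\det(M_{H,K})$, $H\in\mathcal{S}_q(m)$, $K\in\mathcal{S}_q(n)$; thus $\|C_q(M)\|_F^2=\sum_{H,K}\det(M_{H,K})^2$, which is $0$ if $q>\min(m,n)$. Volume sampling is the probability distribution on $\mathcal{S}_r(m)\times\mathcal{S}_k(n)$ given by $$p(I,J)=\zeta^{-1}\det(M_{I,J}^{T}M_{I,J}),\qquad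 \zeta=\sum_{(I,J)\in\mathcal{S}_r(m)\times\mathcal{S}_k(n)}\det(M_{I,J}^{T}M_{I,J}),$$ and $\mathbb{E}$ is the expectation with respect to $p$. *)

(* Defs.v *)
From mathcomp Require Import all_boot all_order all_algebra.
From mathcomp Require Import reals.

Set Implicit Arguments.
Unset Strict Implicit.
Unset Printing Implicit Defensive.

Import Order.TTheory GRing.Theory Num.Theory.

Local Open Scope ring_scope.

(* S_q(N); the index set {1, ..., N} is represented by 'I_N. *)
Definition ksubset (N q : nat) := {A : {set 'I_N} | #|A| == q}.

Lemma card_ksubset (N q : nat) : #|{: ksubset N q}| = 'C(N, q).
Proof.
by rewrite card_sig -[in RHS](card_ord N) -card_draws cardsE.
Qed.

(* The elements of A in increasing order. *)
Definition ksubset_idx (N q : nat) (A : ksubset N q) (i : 'I_q) : 'I_N :=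
  enum_val (cast_ord (esym (eqP (valP A))) i).

Lemma ksubset_idx_lt (N q : nat) (A : ksubset N q) (i j : 'I_q) :
  (i < j)%N -> (ksubset_idx A i < ksubset_idx A j)%N.
Proof.
move=> ltij; rewrite /ksubset_idx.
set i' := cast_ord _ i; set j' := cast_ord _ j.
have s_lt : sorted ltn [seq val x | x <- enum (val A)].
  rewrite {1}/enum_mem -enumT.
  apply: (subseq_sorted ltn_trans (map_subseq _ (filter_subseq _ _))).
  by rewrite val_enum_ord iota_ltn_sorted.
have szE : size [seq val x | x <- enum (val A)] = #|val A|.
  by rewrite size_map cardE.
have valE (x : 'I_#|val A|) :
  nat_of_ord (enum_val x) = nth 0%N [seq val y | y <- enum (val A)] x.
  by rewrite (nth_map (enum_val x)) -?cardE //; congr val; exact: enum_val_nth.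
rewrite !valE; apply: (sorted_ltn_nth ltn_trans 0%N s_lt) => //;
  by rewrite inE szE ltn_ord.
Qed.

Lemma ksubset_idxP (N q : nat) (A : ksubset N q) (x : 'I_N) :
  reflect (exists i, ksubset_idx A i = x) (x \in val A).
Proof.
apply: (iffP idP) => [xA | [i <-]]; last exact: enum_valP.
exists (cast_ord (eqP (valP A)) (enum_rank_in xA x)).
by rewrite /ksubset_idx cast_ordK enum_rankK_in.
Qed.

Definition submatrix (R : realType) (m n r k : nat) (M : 'M[R]_(m, n))
    (I : ksubset m r) (J : ksubset n k) : 'M[R]_(r, k) :=
  mxsub (ksubset_idx I) (ksubset_idx J) M.

Definition rows_of (R : realType) (m n r : nat) (M : 'M[R]_(m, n))
    (I : ksubset m r) : 'M[R]_(r, n) :=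
  rowsub (ksubset_idx I) M.

Definition cols_of (R : realType) (m n k : nat) (M : 'M[R]_(m, n))
    (J : ksubset n k) : 'M[R]_(m, k) :=
  colsub (ksubset_idx J) M.

(* The size is 'C(m, q) x 'C(n, q) by card_ksubset. Rows and columns follow the
   enumeration of the q-subsets chosen by the library. *)
Definition compound (R : realType) (m n q : nat) (M : 'M[R]_(m, n)) :
    'M[R]_(#|{: ksubset m q}|, #|{: ksubset n q}|) :=
  \matrix_(a, b) \det (submatrix M (enum_val a) (enum_val b)).

Definition frobenius_norm (R : realType) (m n : nat) (A : 'M[R]_(m, n)) : R :=
  Num.sqrt (\sum_i \sum_j A i j ^+ 2).

Lemma sqr_frobenius_norm (R : realType) (m n : nat) (A : 'M[R]_(m, n)) :
  frobenius_norm A ^+ 2 = \sum_i \sum_j A i j ^+ 2.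
Proof.
by rewrite sqr_sqrtr //; do 2!apply: sumr_ge0 => ? _; exact: sqr_ge0.
Qed.

Lemma sqr_frobenius_norm_compound (R : realType) (m n q : nat)
    (M : 'M[R]_(m, n)) :
  frobenius_norm (compound q M) ^+ 2
  = \sum_(H : ksubset m q) \sum_(K : ksubset n q) \det (submatrix M H K) ^+ 2.
Proof.
rewrite sqr_frobenius_norm (reindex (@enum_val _ {: ksubset m q})) /=; last first.
  exact/onW_bij/enum_val_bij.
apply: eq_bigr => a _.
rewrite (reindex (@enum_val _ {: ksubset n q})) /=; last first.
  exact/onW_bij/enum_val_bij.
by apply: eq_bigr => b _; rewrite mxE.
Qed.

Definition penrose (R : realType) (m n : nat) (A : 'M[R]_(m, n)) :
    pred 'M[R]_(n, m) := fun X =>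
  [&& A *m X *m A == A, X *m A *m X == X,
      (A *m X)^T == A *m X & (X *m A)^T == X *m A].

Lemma gram_unitmx (R : realType) (m n : nat) (A : 'M[R]_(m, n)) :
  row_free A -> A *m A^T \in unitmx.
Proof.
move=> Afree; rewrite -row_free_unit; apply: inj_row_free => v vAA0.
have vA0 : v *m A = 0.
  have ww0 : (v *m A) *m (v *m A)^T = 0.
    by rewrite trmx_mul !mulmxA -(mulmxA v) vAA0 mul0mx.
  move: (v *m A) ww0 => w /matrixP/(_ 0 0); rewrite !mxE.
  under eq_bigr do rewrite mxE -expr2.
  move=> /eqP; rewrite psumr_eq0 => [/allP w0|i _]; last exact: sqr_ge0.
  apply/rowP => j; rewrite mxE; apply/eqP; rewrite -sqrf_eq0.
  exact/w0/mem_index_enum.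
by apply: (row_free_inj Afree); rewrite /= vA0 mul0mx.
Qed.

Lemma penrose_ex (R : realType) (m n : nat) (A : 'M[R]_(m, n)) :
  exists X, penrose A X.
Proof.
have [s [C [F [AE Cfree Ffree]]]] : exists s (C : 'M[R]_(m, s)) (F : 'M[R]_(s, n)),
    [/\ A = C *m F, row_free C^T & row_free F].
  exists (\rank A), (col_base A), (row_base A); split.
  - by rewrite mulmx_base.
  - by rewrite /row_free mxrank_tr; exact: col_base_full.
  - exact: row_base_free.
pose P := F *m F^T; pose Q := C^T *m C.
have Pu : P \in unitmx by exact: gram_unitmx.
have Qu : Q \in unitmx by rewrite /Q -{2}[C]trmxK; exact: gram_unitmx.
have PT : P^T = P by rewrite trmx_mul trmxK.
have QT : Q^T = Q by rewrite trmx_mul trmxK.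
pose X := F^T *m invmx P *m invmx Q *m C^T.
have AX : A *m X = C *m invmx Q *m C^T.
  by rewrite AE /X !mulmxA -(mulmxA C F) -/P -(mulmxA C P) mulmxV // mulmx1.
have XA : X *m A = F^T *m invmx P *m F.
  by rewrite AE /X !mulmxA -(mulmxA _ C^T C) -/Q -(mulmxA _ (invmx Q) Q) mulVmx // mulmx1.
exists X; apply/and4P; split; apply/eqP.
- by rewrite AX AE !mulmxA -(mulmxA _ C^T C) -/Q -(mulmxA _ (invmx Q) Q) mulVmx // mulmx1.
- by rewrite XA /X !mulmxA -(mulmxA _ F F^T) -/P -(mulmxA _ (invmx P) P) mulVmx // mulmx1.
- by rewrite AX !trmx_mul trmxK trmx_inv QT mulmxA.
- by rewrite XA !trmx_mul trmxK trmx_inv PT mulmxA.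
Qed.

Lemma penrose_uniq (R : realType) (m n : nat) (A : 'M[R]_(m, n))
    (X Y : 'M[R]_(n, m)) : penrose A X -> penrose A Y -> X = Y.
Proof.
move=> /and4P[/eqP a1 /eqP a2 /eqP a3 /eqP a4] /and4P[/eqP b1 /eqP b2 /eqP b3 /eqP b4].
have e1 : A *m X = A *m Y.
  by rewrite -a3 -{1}b1 -mulmxA trmx_mul a3 b3 !mulmxA a1.
have e2 : X *m A = Y *m A.
  by rewrite -a4 -{1}b1 !mulmxA -(mulmxA (X *m A)) trmx_mul a4 b4 -!mulmxA (mulmxA A X) a1.
by rewrite -a2 e2 -mulmxA e1 mulmxA b2.
Qed.

(* The Moore-Penrose pseudoinverse. The library's pinvmx is only a one-sided
   partial inverse and is not the Moore-Penrose pseudoinverse. *)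
Definition mp_pinv (R : realType) (m n : nat) (A : 'M[R]_(m, n)) :
  'M[R]_(n, m) := xchoose (penrose_ex A).

Lemma mp_pinvP (R : realType) (m n : nat) (A : 'M[R]_(m, n)) :
  penrose A (mp_pinv A).
Proof. exact: xchooseP. Qed.

Definition vol2 (R : realType) (m n r k : nat) (M : 'M[R]_(m, n))
    (I : ksubset m r) (J : ksubset n k) : R :=
  \det ((submatrix M I J)^T *m submatrix M I J).

Definition vol_zeta (R : realType) (m n : nat) (r k : nat) (M : 'M[R]_(m, n)) : R :=
  \sum_(I : ksubset m r) \sum_(J : ksubset n k) vol2 M I J.

Definition vol_prob (R : realType) (m n r k : nat) (M : 'M[R]_(m, n))
    (I : ksubset m r) (J : ksubset n k) : R :=
  (vol_zeta r k M)^-1 * vol2 M I J.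

Definition vol_expectation (R : realType) (m n r k : nat) (M : 'M[R]_(m, n))
    (X : ksubset m r -> ksubset n k -> R) : R :=
  \sum_(I : ksubset m r) \sum_(J : ksubset n k) vol_prob M I J * X I J.

Definition cur (R : realType) (m n r k : nat) (M : 'M[R]_(m, n))
    (I : ksubset m r) (J : ksubset n k) : 'M[R]_(m, n) :=
  cols_of M J *m mp_pinv (submatrix M I J) *m rows_of M I.

(* Main.v *)
Require Import Defs.
From mathcomp Require Import all_boot all_order all_algebra.
From mathcomp Require Import reals.
From mathcomp Require Import all_fingroup ring.
Import Order.TTheory GRing.Theory Num.Theory.
Local Open Scope ring_scope.

(** The estimate comes from reading every quantity as a sum of squares of
    minors of [M], and then counting.

    Fix [I] and [J], put [A = M_{I,J}] and suppose that [G = A^T A] is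
    invertible (otherwise the pair has probability zero).  Then
    [A^+ = G^-1 A^T], so column [j] of [CUR] is [M_{:,J} x], where [x] is the
    least-squares solution of [A x ~ M_{I,j}].  Two facts bound the error, both
    consequences of a Cauchy-Binet formula in which some rows are left
    unexpanded ([bordered_cauchy_binet]) and of a Schur complement
    ([det_bordered]).
    - For each row [i], [det G] times the error at [(i, j)] is the sum, over
      the [k]-subsets [H] of [I], of [det M_{H,J}] times the minor of [M] with
      [i] added to [H] and [j] added to [J] ([residual_minors]).  Since [det G]
      is the sum of the [det M_{H,J} ^ 2], Cauchy-Schwarz bounds [det G] times
      the squared error by the sum of the squares of the added minors
      ([error_entry_le]).
    - The errors at the rows of [I] form a least-squares residual, whose squared
      length times [det G] is a Gram determinant of size [k + 1]
      ([residual_gram]).  So these rows together contribute exactly the sum of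
      squares of the minors with rows in [I] and columns [J] and [j], each taken
      once ([error_entries_in]).  The bound of the first item would count each of
      them [k + 1] times, once for each choice of [i] among its rows.  This is
      where the second, smaller term of the theorem comes from.

    Summing over [I], a set of [q] rows lies in [C(m - q, m - r)] of the sets
    [I].  The ratio of these numbers for [q = k + 1] and [q = k] is
    [(r - k) / (m - k)], which produces the two weights ([sum_vol2_error]).  The
    same count gives the normalisation ([vol_zetaE]).

    Sums over [q]-subsets are handled as sums over all functions from ['I_q],
    at the price of a factor [q!] ([sum_ffun_ksubset]): the summands are squared
    minors, which vanish on functions that are not injective and are unchanged by
    permutations.  With functions, adding an index is just [fcons], and there are
    no signs to follow. *)

Set Implicit Arguments.
Unset Strict Implicit.
Unset Printing Implicit Defensive.

(** * Cauchy-Binet and least-squares residuals *)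

(** Expanding only the last [k] rows by multilinearity gives the formula before
    symmetrisation, with [\prod_b X b (f b)] in place of a determinant.  Averaging
    over the [k!] permutations of the argument of [f] turns these products into
    [\det (colsub f X)].  Summing over all functions rather than over subsets
    accounts for the factor [k!]. *)
Lemma bordered_cauchy_binet (R : comNzRingType) (p k r : nat)
    (u : 'M[R]_(p, p + k)) (X : 'M[R]_(k, r)) (Y : 'M[R]_(r, p + k)) :
  k`!%:R * \det (col_mx u (X *m Y)) =
  \sum_(f : {ffun 'I_k -> 'I_r})
    \det (colsub f X) * \det (col_mx u (rowsub f Y)).
Proof.
have expand : \det (col_mx u (X *m Y)) =
    \sum_(f : {ffun 'I_k -> 'I_r})
      (\prod_b X b (f b)) * \det (col_mx u (rowsub f Y)).
  under [RHS]eq_bigr do rewrite /determinant mulr_sumr.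
  rewrite exchange_big; apply: eq_bigr => s _.
  under [RHS]eq_bigr do rewrite mulrCA.
  rewrite -mulr_sumr; congr (_ * _); rewrite big_split_ord /=.
  under [RHS]eq_bigr do rewrite big_split_ord /= mulrCA.
  under [X in X * _]eq_bigr do rewrite col_mxEu.
  under [X in _ * X]eq_bigr do rewrite col_mxEd mxE.
  rewrite bigA_distr_bigA mulr_sumr; apply: eq_bigr => f _.
  congr (_ * _); first by apply: eq_bigr => a _; rewrite col_mxEu.
  by rewrite -big_split; apply: eq_bigr => b _; rewrite col_mxEd !mxE.
have alternate (s : 'S_k) (f : {ffun 'I_k -> 'I_r}) :
    \det (col_mx u (rowsub (f \o s) Y)) =
    (-1) ^+ s * \det (col_mx u (rowsub f Y)).
  have -> : col_mx u (rowsub (f \o s) Y) =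
      block_mx 1%:M 0 0 (perm_mx s) *m col_mx u (rowsub f Y).
    rewrite mul_block_col mul1mx !mul0mx addr0 add0r -row_permE.
    by congr col_mx; apply/matrixP => a b; rewrite !mxE.
  by rewrite det_mulmx det_ublock det1 mul1r det_perm.
have precomp (s : 'S_k) : bijective (fun f : {ffun 'I_k -> 'I_r} =>
    [ffun b => f (s b)]).
  exists (fun f : {ffun 'I_k -> 'I_r} => [ffun b => f ((s^-1)%g b)]) => f;
    by apply/ffunP => b; rewrite !ffunE ?permK ?permKV.
rewrite expand -card_Sn -(cardsT 'S_k) -sum1_card natr_sum mulr_suml.
under eq_bigl do rewrite inE.
under eq_bigr => s _.
  rewrite mul1r (reindex _ (onW_bij _ (precomp s))).
  under eq_bigr => f _.
    have -> : rowsub [ffun b => f (s b)] Y = rowsub (f \o s) Y.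
      by apply/matrixP => a b; rewrite !mxE ffunE.
    rewrite alternate mulrA.
    over.
  over.
rewrite exchange_big; apply: eq_bigr => f _ /=.
rewrite -mulr_suml; congr (_ * _); apply: eq_bigr => s _.
rewrite mulrC; congr (_ * _); apply: eq_bigr => b _.
by rewrite mxE ffunE.
Qed.

Lemma det_gram (R : comNzRingType) (k r : nat) (A : 'M[R]_(r, k)) :
  k`!%:R * \det (A^T *m A) =
  \sum_(f : {ffun 'I_k -> 'I_r}) \det (rowsub f A) ^+ 2.
Proof.
have col0 q (B : 'M[R]_(k, q)) : col_mx (0 : 'M_(0, q)) B = B.
  apply/matrixP => i j; rewrite mxE; case: splitP => [[] // | l eq_il].
  by congr (B _ _); apply: val_inj; rewrite /= eq_il.
have := @bordered_cauchy_binet R 0 k r 0 A^T A; rewrite col0 => ->.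
apply: eq_bigr => f _; rewrite col0 expr2 -[\det (colsub _ _)]det_tr.
by rewrite trmx_mxsub trmxK.
Qed.

(** Subtracting from the first column the combination of the other columns with
    coefficients [x] makes the matrix block triangular; the entry left in the
    corner is the Schur complement of [G]. *)
Lemma det_bordered (R : comNzRingType) (k : nat)
    (a : 'M[R]_1) (v : 'rV_k) (x : 'cV_k) (G : 'M_k) :
  \det (block_mx a v (G *m x) G) = \det G * (a - v *m x) 0 0.
Proof.
have eqB : block_mx a v (G *m x) G *m block_mx 1%:M 0 (- x) 1%:M =
    block_mx (a - v *m x) v 0 G.
  by rewrite mulmx_block !mulmx1 !mulmx0 !add0r !mulmxN subrr.
have := congr1 determinant eqB.
by rewrite det_mulmx det_lblock !det1 !mulr1 det_ublock det_mx11 mulrC.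
Qed.

(** The normal equations make the bordered matrix on the left of
    [bordered_cauchy_binet] one to which [det_bordered] applies.  Read for a row
    [(c, w)] of a larger system, this says that the residual of that row is a
    weighted mean of its residuals for the exact solutions of all [k]-row
    subsystems, with weights [\det (rowsub f A) ^+ 2]. *)
Lemma residual_minors (R : comNzRingType) (k r : nat)
    (A : 'M[R]_(r, k)) (b : 'cV_r) (c : 'M_1) (w : 'rV_k) (x : 'cV_k) :
  A^T *m A *m x = A^T *m b ->
  k`!%:R * \det (A^T *m A) * (c - w *m x) 0 0 =
  \sum_(f : {ffun 'I_k -> 'I_r}) \det (rowsub f A) *
    \det (block_mx c w (rowsub f b) (rowsub f A)).
Proof.
move=> normal; rewrite -mulrA -det_bordered normal /block_mx -mul_mx_row.
rewrite (@bordered_cauchy_binet R 1); apply: eq_bigr => f _.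
rewrite -[\det (colsub _ _)]det_tr trmx_mxsub trmxK; congr (_ * \det (col_mx _ _)).
apply/matrixP => i j; rewrite !mxE; case: split => ?; by rewrite !mxE.
Qed.

(** The residual is orthogonal to the columns of [A], so its squared length is the
    Schur complement [b^T b - b^T A x] in the Gram matrix of [b] and [A]. *)
Lemma residual_gram (R : comNzRingType) (k r : nat)
    (A : 'M[R]_(r, k)) (b : 'cV_r) (x : 'cV_k) :
  A^T *m A *m x = A^T *m b ->
  \det (A^T *m A) * (\sum_i (b - A *m x) i 0 ^+ 2) =
  \det ((row_mx b A)^T *m row_mx b A).
Proof.
move=> normal.
rewrite tr_row_mx mul_col_row -normal det_bordered; congr (_ * _).
have -> : \sum_i (b - A *m x) i 0 ^+ 2 = ((b - A *m x)^T *m (b - A *m x)) 0 0.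
  by rewrite [RHS]mxE; apply: eq_bigr => i _; rewrite [_^T 0 i]mxE expr2.
rewrite [(b - _)^T]linearB /= trmx_mul mulmxBl.
have ortho : A^T *m (b - A *m x) = 0 by rewrite mulmxBr mulmxA normal subrr.
by rewrite -[x^T *m _ *m _]mulmxA ortho mulmx0 subr0 mulmxBr !mulmxA.
Qed.

(** The number [t] is the mean of the ratios [b f / a f] with weights [a f ^+ 2],
    so this is Jensen's inequality for the square, without division: it expands
    [\sum_f (b f - t * a f) ^+ 2 >= 0]. *)
Lemma weighted_jensen (R : realDomainType) (T : finType) (a b : T -> R) (t : R) :
  \sum_f a f * b f = (\sum_f a f ^+ 2) * t ->
  (\sum_f a f ^+ 2) * t ^+ 2 <= \sum_f b f ^+ 2.
Proof.
move=> ab; rewrite -subr_ge0.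
suff <- : \sum_f (b f - t * a f) ^+ 2 =
    \sum_f b f ^+ 2 - (\sum_f a f ^+ 2) * t ^+ 2.
  by apply: sumr_ge0 => f _; exact: sqr_ge0.
under eq_bigr => f _.
  have -> : (b f - t * a f) ^+ 2 =
    b f ^+ 2 - (a f * b f) * (t *+ 2) + a f ^+ 2 * t ^+ 2 by ring.
  over.
rewrite !big_split /= sumrN -!mulr_suml ab; ring.
Qed.

Lemma mp_pinv_gram (R : realType) (m n : nat) (A : 'M[R]_(m, n)) :
  A^T *m A \in unitmx -> mp_pinv A = invmx (A^T *m A) *m A^T.
Proof.
set G := A^T *m A => Gu.
have GT : G^T = G by rewrite trmx_mul trmxK.
apply: (penrose_uniq (mp_pinvP A)); apply/and4P.
have XA : invmx G *m A^T *m A = 1%:M by rewrite -mulmxA mulVmx.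
split; apply/eqP.
- by rewrite -mulmxA XA mulmx1.
- by rewrite XA mul1mx.
- by rewrite !trmx_mul trmxK trmx_inv GT mulmxA.
- by rewrite XA trmx1.
Qed.

(** * Functions in place of subsets *)

Definition fcons (T : Type) (k : nat) (x : T) (f : {ffun 'I_k -> T}) :
    {ffun 'I_k.+1 -> T} :=
  [ffun a => oapp f x (unlift ord0 a)].

Lemma fcons0 (T : Type) (k : nat) (x : T) (f : {ffun 'I_k -> T}) :
  fcons x f ord0 = x.
Proof. by rewrite ffunE unlift_none. Qed.

Lemma fcons_lift (T : Type) (k : nat) (x : T) (f : {ffun 'I_k -> T}) a :
  fcons x f (lift ord0 a) = f a.
Proof. by rewrite ffunE liftK. Qed.

Lemma fcons_lshift (T : Type) (k : nat) (x : T) (f : {ffun 'I_k -> T})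
    (a : 'I_1) : fcons x f (lshift k a) = x.
Proof. by rewrite -[RHS](fcons0 x f); congr (fcons x f _); rewrite ord1; exact: val_inj. Qed.

Lemma fcons_rshift (T : Type) (k : nat) (x : T) (f : {ffun 'I_k -> T}) a :
  fcons x f (rshift 1 a) = f a.
Proof. by rewrite -(fcons_lift x f); congr (fcons x f _); exact: val_inj. Qed.

Lemma fcons_noninj (T : eqType) (k : nat) (x : T) (f : {ffun 'I_k -> T}) :
  ~~ injectiveb f -> ~~ injectiveb (fcons x f).
Proof.
case/injectivePn=> [a [b neq_ab eq_f]]; apply/injectivePn.
exists (lift ord0 a), (lift ord0 b); last by rewrite !fcons_lift.
by apply: contraNneq neq_ab => /lift_inj->.
Qed.

Lemma sum_fcons (R : nmodType) (T : finType) (k : nat)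
    (F : {ffun 'I_k.+1 -> T} -> R) :
  \sum_f F f = \sum_x \sum_(f : {ffun 'I_k -> T}) F (fcons x f).
Proof.
rewrite pair_big /= (reindex (fun u : T * {ffun 'I_k -> T} => fcons u.1 u.2)) //=.
exists (fun f => (f ord0, [ffun a => f (lift ord0 a)])) => [[x f] _ | f _] /=.
  by rewrite fcons0; congr pair; apply/ffunP => a; rewrite ffunE fcons_lift.
apply/ffunP => a; case: (unliftP ord0 a) => [b ->|->].
  by rewrite fcons_lift ffunE.
by rewrite fcons0.
Qed.

Lemma ksubset_idx_inj (N q : nat) (A : ksubset N q) : injective (ksubset_idx A).
Proof. by move=> i j /enum_val_inj/cast_ord_inj. Qed.

(** An injective function on ['I_q] is the increasing enumeration of its image
    preceded by a permutation, in a unique way.  Uniqueness is checked directly;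
    existence follows by comparing cardinalities. *)
Lemma sum_ffun_ksubset (R : pzRingType) (N q : nat)
    (F : {ffun 'I_q -> 'I_N} -> R) :
    (forall f : {ffun 'I_q -> 'I_N}, ~~ injectiveb f -> F f = 0) ->
    (forall (f : {ffun 'I_q -> 'I_N}) (s : 'S_q), F [ffun a => f (s a)] = F f) ->
  \sum_f F f = q`!%:R * \sum_(A : ksubset N q) F (finfun (ksubset_idx A)).
Proof.
move=> F0 Fs.
pose h (u : ksubset N q * 'S_q) : {ffun 'I_q -> 'I_N} :=
  [ffun a => ksubset_idx u.1 (u.2 a)].
have h_inj : injective h.
  move=> [A s] [B t] /ffunP eq_h.
  have eqAB : A = B.
    apply/val_inj/setP => x; apply/ksubset_idxP/ksubset_idxP => -[a <-].
      by exists (t ((s^-1)%g a)); have := eq_h ((s^-1)%g a); rewrite !ffunE /= permKV.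
    by exists (s ((t^-1)%g a)); have := eq_h ((t^-1)%g a); rewrite !ffunE /= permKV.
  rewrite -eqAB in eq_h *; congr pair; apply/permP => a.
  by have := eq_h a; rewrite !ffunE /= => /ksubset_idx_inj.
have h_im : h @: setT = [set f : {ffun 'I_q -> 'I_N} | injectiveb f].
  apply/eqP; rewrite eqEcard; apply/andP; split.
    apply/subsetP => _ /imsetP[[A s] _ ->]; rewrite inE; apply/injectiveP => a b.
    by rewrite !ffunE => /ksubset_idx_inj/perm_inj.
  rewrite card_inj_ffuns card_imset // cardsT card_prod card_ksubset.
  by rewrite card_Sn !card_ord bin_ffact.
rewrite (bigID (fun f : {ffun 'I_q -> 'I_N} => injectiveb f)) /= [X in _ + X]big1 // addr0.
transitivity (\sum_(f in h @: setT) F f).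
  by apply: eq_bigl => f; rewrite h_im inE.
rewrite big_imset /=; last by move=> ? ? _ _; exact: h_inj.
transitivity (\sum_(A : ksubset N q) \sum_(s : 'S_q) F (h (A, s))).
  by rewrite pair_big /=; apply: eq_big => [u|[]] //; rewrite inE.
rewrite mulr_sumr; apply: eq_bigr => A _.
rewrite -card_Sn mulr_natl -sumr_const; apply: eq_bigr => s _.
by rewrite -[RHS](Fs _ s); congr F; apply/ffunP => a; rewrite !ffunE.
Qed.

Lemma sum_ffun_into (R : nmodType) (N r k : nat) (I : ksubset N r)
    (F : {ffun 'I_k -> 'I_N} -> R) :
  \sum_(f : {ffun 'I_k -> 'I_r}) F [ffun a => ksubset_idx I (f a)] =
  \sum_(f : {ffun 'I_k -> 'I_N} | [forall a, f a \in val I]) F f.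
Proof.
pose h (f : {ffun 'I_k -> 'I_r}) := [ffun a => ksubset_idx I (f a)].
have h_inj : injective h.
  move=> f g /ffunP eq_h; apply/ffunP => a.
  by have := eq_h a; rewrite !ffunE => /ksubset_idx_inj.
transitivity (\sum_(f in h @: setT) F f).
  by rewrite big_imset /= => [|? ? _ _]; [apply: eq_bigl => f; rewrite inE|exact: h_inj].
apply: eq_bigl => f; apply/imsetP/forallP => [[g _ ->] a | fI].
  by rewrite ffunE; apply/ksubset_idxP; exists (g a).
have {}fI a : exists b, ksubset_idx I b == f a.
  by have /ksubset_idxP[b <-] := fI a; exists b.
exists [ffun a => xchoose (fI a)] => //.
by apply/ffunP => a; rewrite !ffunE; apply/esym/eqP/(xchooseP (fI a)).
Qed.

Lemma sum_ksubset_idx (R : nmodType) (N r : nat) (I : ksubset N r)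
    (F : 'I_N -> R) :
  \sum_(a < r) F (ksubset_idx I a) = \sum_(i in val I) F i.
Proof.
transitivity (\sum_(i in ksubset_idx I @: setT) F i).
  rewrite big_imset /= => [|? ? _ _]; last exact: ksubset_idx_inj.
  by apply: eq_bigl => a; rewrite inE.
apply: eq_bigl => i; apply/imsetP/ksubset_idxP => [[a _ ->]|[a <-]]; by exists a.
Qed.

(** Complements of the sets counted are the [(N - r)]-subsets of the complement of
    [X].  Stated in this form the count is also correct when [X] has more than
    [r] elements. *)
Lemma card_supersets (N r : nat) (X : {set 'I_N}) : (r <= N)%N ->
  #|[set I : ksubset N r | X \subset val I]| = 'C(N - #|X|, N - r).
Proof.
move=> le_rN; pose h (I : ksubset N r) := ~: val I.
have h_inj : injective h by move=> I I' /setC_inj/val_inj.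
rewrite -(card_imset _ h_inj).
have -> : (N - #|X|)%N = #|~: X| by rewrite [RHS]cardsCs setCK card_ord.
rewrite -cards_draws; congr #|pred_of_set _|; apply/setP => B.
rewrite inE; apply/imsetP/andP => [[I]|[BX /eqP cB]].
  rewrite inE => XI ->; rewrite setCS XI; split=> //.
  by rewrite cardsCs setCK card_ord (eqP (valP I)).
have cCB : #|~: B| == r by rewrite cardsCs setCK card_ord cB subKn.
by exists (Sub (~: B) cCB); rewrite ?inE /h /= ?setCK // -setCS setCK.
Qed.

(** * Minors *)

Definition minor (R : comNzRingType) (m n q : nat) (M : 'M[R]_(m, n))
    (f : {ffun 'I_q -> 'I_m}) (g : {ffun 'I_q -> 'I_n}) : R :=
  \det (mxsub f g M).

Lemma minor_tr (R : comNzRingType) (m n q : nat) (M : 'M[R]_(m, n))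
    (f : {ffun 'I_q -> 'I_m}) (g : {ffun 'I_q -> 'I_n}) :
  minor M^T g f = minor M f g.
Proof. by rewrite /minor -[RHS]det_tr trmx_mxsub. Qed.

Lemma minor_noninj (R : comNzRingType) (m n q : nat) (M : 'M[R]_(m, n))
    (f : {ffun 'I_q -> 'I_m}) (g : {ffun 'I_q -> 'I_n}) :
  ~~ injectiveb f -> minor M f g = 0.
Proof.
move=> /injectivePn[a [b neq_ab eq_f]]; apply: (determinant_alternate neq_ab) => j.
by rewrite !mxE eq_f.
Qed.

Lemma sqr_minor_perm (R : comNzRingType) (m n q : nat) (M : 'M[R]_(m, n))
    (f : {ffun 'I_q -> 'I_m}) (g : {ffun 'I_q -> 'I_n}) (s : 'S_q) :
  minor M [ffun a => f (s a)] g ^+ 2 = minor M f g ^+ 2.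
Proof.
have -> : minor M [ffun a => f (s a)] g = (-1) ^+ s * minor M f g.
  rewrite /minor -det_perm -det_mulmx -row_permE; congr determinant.
  by apply/matrixP => a b; rewrite !mxE ffunE.
by rewrite exprMn sqrr_sign mul1r.
Qed.

Lemma sum_sqr_minors_cols (R : comNzRingType) (m n q : nat) (M : 'M[R]_(m, n))
    (f : {ffun 'I_q -> 'I_m}) :
  \sum_(g : {ffun 'I_q -> 'I_n}) minor M f g ^+ 2 =
  q`!%:R * \sum_(J : ksubset n q) minor M f (finfun (ksubset_idx J)) ^+ 2.
Proof.
apply: (sum_ffun_ksubset (F := fun g => minor M f g ^+ 2)) => [g ninj | g s].
  by rewrite -minor_tr minor_noninj // expr0n.
by rewrite -minor_tr sqr_minor_perm minor_tr.
Qed.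

Lemma sum_sqr_minors_rows (R : comNzRingType) (m n q : nat) (M : 'M[R]_(m, n))
    (g : {ffun 'I_q -> 'I_n}) :
  \sum_(f : {ffun 'I_q -> 'I_m}) minor M f g ^+ 2 =
  q`!%:R * \sum_(I : ksubset m q) minor M (finfun (ksubset_idx I)) g ^+ 2.
Proof.
under eq_bigr do rewrite -minor_tr; under [X in _ = _ * X]eq_bigr do rewrite -minor_tr.
exact: sum_sqr_minors_cols.
Qed.

Lemma sqr_frobenius_compound (R : realType) (m n q : nat) (M : 'M[R]_(m, n)) :
  q`!%:R ^+ 2 * frobenius_norm (compound q M) ^+ 2 =
  \sum_(f : {ffun 'I_q -> 'I_m}) \sum_(g : {ffun 'I_q -> 'I_n}) minor M f g ^+ 2.
Proof.
rewrite sqr_frobenius_norm_compound expr2 -mulrA.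
under [RHS]eq_bigr do rewrite sum_sqr_minors_cols.
rewrite -mulr_sumr [X in _ = _ * X]exchange_big /=; congr (_ * _).
under [RHS]eq_bigr do rewrite sum_sqr_minors_rows.
rewrite -mulr_sumr [X in _ = _ * X]exchange_big /=; congr (_ * _).
apply: eq_bigr => I _; apply: eq_bigr => J _; congr (_ ^+ 2); congr determinant.
by apply/matrixP => a b; rewrite !mxE !ffunE.
Qed.

(** Every [k+1]-tuple of columns is obtained exactly once by adding one column to
    a [k]-tuple; only the [k]-tuple is then replaced by a subset.  This is the form
    in which the columns [J] and [j] of the error appear. *)
Lemma sum_sqr_minors_fcons (R : comNzRingType) (m n k : nat) (M : 'M[R]_(m, n))
    (f : {ffun 'I_k.+1 -> 'I_m}) :
  \sum_(g : {ffun 'I_k.+1 -> 'I_n}) minor M f g ^+ 2 =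
  k`!%:R * \sum_(J : ksubset n k) \sum_j
    minor M f (fcons j (finfun (ksubset_idx J))) ^+ 2.
Proof.
rewrite sum_fcons exchange_big /=.
apply: (sum_ffun_ksubset (F := fun g => \sum_j minor M f (fcons j g) ^+ 2)).
  move=> g ninj; apply: big1 => j _.
  by rewrite -minor_tr minor_noninj ?expr0n ?fcons_noninj.
move=> g s; apply: eq_bigr => j _.
rewrite -[minor _ _ _]minor_tr -[in RHS]minor_tr.
rewrite -[RHS](sqr_minor_perm _ _ _ (lift_perm ord0 ord0 s)).
congr (minor _ _ _ ^+ 2).
apply/ffunP => a; rewrite [RHS]ffunE; case: (unliftP ord0 a) => [b ->|->].
  by rewrite lift_perm_lift !fcons_lift ffunE.
by rewrite lift_perm_id !fcons0.
Qed.

Lemma mxsub_fcons (R : nzRingType) (m n k : nat) (M : 'M[R]_(m, n))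
    (i : 'I_m) (f : {ffun 'I_k -> 'I_m}) (j : 'I_n) (g : {ffun 'I_k -> 'I_n}) :
  mxsub (fcons i f) (fcons j g) M =
  block_mx (M i j)%:M (row i (colsub g M)) (col j (rowsub f M)) (mxsub f g M).
Proof.
apply/matrixP => a b; rewrite mxE.
case: (@split_ordP 1 k a) => {}a ->; case: (@split_ordP 1 k b) => {}b ->.
- by rewrite (@block_mxEul _ 1 k 1 k) !fcons_lshift !ord1 mxE.
- by rewrite (@block_mxEur _ 1 k 1 k) fcons_lshift fcons_rshift !mxE.
- by rewrite (@block_mxEdl _ 1 k 1 k) fcons_rshift fcons_lshift !mxE.
- by rewrite (@block_mxEdr _ 1 k 1 k) !fcons_rshift !mxE.
Qed.

(** * The error for one pair of index sets *)

Lemma vol2_minors (R : realType) (m n r k : nat) (M : 'M[R]_(m, n))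
    (I : ksubset m r) (J : ksubset n k) :
  k`!%:R * vol2 M I J =
  \sum_(f : {ffun 'I_k -> 'I_m} | [forall a, f a \in val I])
    minor M f (finfun (ksubset_idx J)) ^+ 2.
Proof.
rewrite /vol2 det_gram.
rewrite -(sum_ffun_into I (fun f => minor M f (finfun (ksubset_idx J)) ^+ 2)).
apply: eq_bigr => f _; congr (_ ^+ 2); congr determinant.
by apply/matrixP => a b; rewrite !mxE !ffunE.
Qed.

(** The [k] rows taken from [I] are given by functions, so that each set of rows
    counts [k!] times. *)
Definition sqr_bordered_minors (R : realType) (m n r k : nat) (M : 'M[R]_(m, n))
    (I : ksubset m r) (J : ksubset n k) (i : 'I_m) (j : 'I_n) : R :=
  \sum_(f : {ffun 'I_k -> 'I_m} | [forall a, f a \in val I])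
    minor M (fcons i f) (fcons j (finfun (ksubset_idx J))) ^+ 2.

Lemma sqr_bordered_minorsE (R : realType) (m n r k : nat) (M : 'M[R]_(m, n))
    (I : ksubset m r) (J : ksubset n k) (i : 'I_m) (j : 'I_n) :
  sqr_bordered_minors M I J i j = \sum_(f : {ffun 'I_k -> 'I_r})
    \det (block_mx (M i j)%:M (row i (cols_of M J))
      (rowsub f (col j (rows_of M I))) (rowsub f (submatrix M I J))) ^+ 2.
Proof.
rewrite /sqr_bordered_minors -(sum_ffun_into I
  (fun f => minor M (fcons i f) (fcons j (finfun (ksubset_idx J))) ^+ 2)).
apply: eq_bigr => f _; congr (_ ^+ 2); rewrite /minor mxsub_fcons.
by apply: congr1; apply: f_equal4 => //; apply/matrixP => a b; rewrite !mxE !ffunE.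
Qed.

Lemma entry_sub_mulmx (R : pzRingType) (m n k : nat) (M : 'M[R]_(m, n))
    (C : 'M_(m, k)) (X : 'M_(k, n)) i j :
  (M - C *m X) i j = ((M i j)%:M - row i C *m col j X) 0 0.
Proof.
rewrite !mxE mulr1n; congr (_ - _).
by apply: eq_bigr => a _; rewrite !mxE.
Qed.

Lemma mulmx_col_eq (R : pzRingType) (p q n : nat) (A : 'M[R]_(p, q)) (X : 'M_(q, n))
    (B : 'M_(p, n)) j :
  A *m X = B -> A *m col j X = col j B.
Proof. by move=> <-; rewrite !colE mulmxA. Qed.

(** For pairs of positive probability, [CUR] solves in each column the
    least-squares problem restricted to the rows [I].  The normal equations are all
    that the error estimates use about the pseudoinverse. *)
Lemma cur_normal (R : realType) (m n r k : nat) (M : 'M[R]_(m, n))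
    (I : ksubset m r) (J : ksubset n k) (A := submatrix M I J) :
  vol2 M I J != 0 ->
  exists2 X, A^T *m A *m X = A^T *m rows_of M I & cur M I J = cols_of M J *m X.
Proof.
move=> Vneq0; have Gu : A^T *m A \in unitmx by rewrite unitmxE unitfE.
exists (mp_pinv A *m rows_of M I); last by rewrite mulmxA.
by rewrite mp_pinv_gram // !mulmxA mulmxV // mul1mx.
Qed.

Lemma error_entry_le (R : realType) (m n r k : nat) (M : 'M[R]_(m, n))
    (I : ksubset m r) (J : ksubset n k) (A := submatrix M I J) (X : 'M_(k, n))
    (i : 'I_m) (j : 'I_n) :
  A^T *m A *m X = A^T *m rows_of M I ->
  k`!%:R * (vol2 M I J * (M - cols_of M J *m X) i j ^+ 2) <=
  sqr_bordered_minors M I J i j.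
Proof.
move=> normal; have normal_j : A^T *m A *m col j X = A^T *m col j (rows_of M I).
  by rewrite (mulmx_col_eq _ normal) !colE mulmxA.
rewrite sqr_bordered_minorsE entry_sub_mulmx mulrA /vol2 det_gram.
by apply: weighted_jensen; rewrite -det_gram -(residual_minors _ _ normal_j).
Qed.

(** Adding to the functions into [I] one more value in [I] gives each function on
    ['I_k.+1] into [I] exactly once, which turns the Gram determinant of
    [residual_gram] into a sum over [i] of bordered minors. *)
Lemma error_entries_in (R : realType) (m n r k : nat) (M : 'M[R]_(m, n))
    (I : ksubset m r) (J : ksubset n k) (A := submatrix M I J) (X : 'M_(k, n))
    (j : 'I_n) :
  A^T *m A *m X = A^T *m rows_of M I ->
  (k.+1)`!%:R *
    (vol2 M I J * \sum_(i in val I) (M - cols_of M J *m X) i j ^+ 2) =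
  \sum_(i in val I) sqr_bordered_minors M I J i j.
Proof.
move=> normal; have normal_j : A^T *m A *m col j X = A^T *m col j (rows_of M I).
  by rewrite (mulmx_col_eq _ normal) !colE mulmxA.
rewrite -!sum_ksubset_idx.
have -> : \sum_(a < r) (M - cols_of M J *m X) (ksubset_idx I a) j ^+ 2 =
    \sum_(a < r) (col j (rows_of M I) - A *m col j X) a 0 ^+ 2.
  apply: eq_bigr => a _; congr (_ ^+ 2); rewrite !mxE; congr (_ - _).
  by apply: eq_bigr => b _; rewrite !mxE.
rewrite residual_gram // (@det_gram _ k.+1) sum_fcons; apply: eq_bigr => a _.
rewrite sqr_bordered_minorsE; apply: eq_bigr => f _; congr (\det _ ^+ 2).
apply/matrixP => c e; rewrite mxE.
case: (@split_ordP 1 k c) => {}c ->; case: (@split_ordP 1 k e) => {}e ->.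
- by rewrite (@row_mxEl _ r 1 k) (@block_mxEul _ 1 k 1 k) fcons_lshift !mxE !ord1.
- by rewrite (@row_mxEr _ r 1 k) (@block_mxEur _ 1 k 1 k) fcons_lshift !mxE.
- by rewrite (@row_mxEl _ r 1 k) (@block_mxEdl _ 1 k 1 k) fcons_rshift !mxE.
- by rewrite (@row_mxEr _ r 1 k) (@block_mxEdr _ 1 k 1 k) fcons_rshift !mxE.
Qed.

(** The bound of [error_entry_le], multiplied by [(k+1)! / k!], serves the rows
    outside [I]; the rows of [I] together satisfy the equality of
    [error_entries_in], which saves the factor [k + 1]. *)
Lemma vol2_error (R : realType) (m n r k : nat) (M : 'M[R]_(m, n))
    (I : ksubset m r) (J : ksubset n k) :
  (k.+1)`!%:R * (vol2 M I J * frobenius_norm (cur M I J - M) ^+ 2) <=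
  \sum_j \sum_i
    (if i \in val I then 1 else k.+1%:R) * sqr_bordered_minors M I J i j.
Proof.
have [V0|/cur_normal[X normal ->]] := eqVneq (vol2 M I J) 0.
  rewrite V0 mul0r mulr0; apply: sumr_ge0 => j _; apply: sumr_ge0 => i _.
  apply: mulr_ge0; first by case: ifP.
  by apply: sumr_ge0 => f _; exact: sqr_ge0.
rewrite sqr_frobenius_norm exchange_big /= mulr_sumr mulr_sumr.
apply: ler_sum => j _.
have -> : \sum_i (cols_of M J *m X - M) i j ^+ 2 =
    \sum_i (M - cols_of M J *m X) i j ^+ 2.
  by apply: eq_bigr => i _; rewrite -sqrrN -opprB [in LHS]mxE opprK.
rewrite (bigID (fun i => i \in val I)) /= [leRHS](bigID (fun i => i \in val I)) /=.
rewrite !mulrDr; apply: lerD.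
  by rewrite (error_entries_in _ normal); apply: ler_sum => i ->; rewrite mul1r.
rewrite !mulr_sumr; apply: ler_sum => i /negPf ->.
by rewrite factS natrM -mulrA ler_wpM2l // error_entry_le.
Qed.

(** * Averaging over the index sets *)

Lemma sum_supersets (R : pzRingType) (N r q : nat)
    (F : {ffun 'I_q -> 'I_N} -> R) :
    (r <= N)%N ->
    (forall f : {ffun 'I_q -> 'I_N}, ~~ injectiveb f -> F f = 0) ->
  \sum_(I : ksubset N r)
    \sum_(f : {ffun 'I_q -> 'I_N} | [forall a, f a \in val I]) F f =
  'C(N - q, N - r)%:R * \sum_f F f.
Proof.
move=> le_rN F0; rewrite (exchange_big_dep predT) //= mulr_sumr.
apply: eq_bigr => f _; have [f_inj|/F0 ->] := boolP (injectiveb f); last first.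
  by rewrite mulr0 big1.
rewrite sumr_const mulr_natl; congr (_ *+ _).
have card_im : #|f @: setT| = q.
  by rewrite card_imset ?cardsT ?card_ord //; exact/injectiveP.
rewrite -[in RHS]card_im -card_supersets // cardsE; apply: eq_card => I.
apply/forallP/subsetP => [fI _ /imsetP[a _ ->] // | fI a].
by apply: fI; apply: imset_f.
Qed.

(** The weight is [k + 1] for every [i], minus [k] for the [i] in [I].  Without
    restriction on [i], only the [k] values of [f] constrain [I]; with [i] in [I],
    the [k + 1] values of [fcons i f] do.  This explains the two binomials. *)
Lemma sum_weighted_supersets (R : comPzRingType) (N r k : nat)
    (F : {ffun 'I_k.+1 -> 'I_N} -> R) :
    (r <= N)%N ->
    (forall f : {ffun 'I_k.+1 -> 'I_N}, ~~ injectiveb f -> F f = 0) ->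
  \sum_(I : ksubset N r) \sum_i (if i \in val I then 1 else k.+1%:R) *
    \sum_(f : {ffun 'I_k -> 'I_N} | [forall a, f a \in val I]) F (fcons i f) =
  (k.+1%:R * 'C(N - k, N - r)%:R - k%:R * 'C(N - k.+1, N - r)%:R) *
    \sum_f F f.
Proof.
move=> le_rN F0.
pose S (I : ksubset N r) i :=
  \sum_(f : {ffun 'I_k -> 'I_N} | [forall a, f a \in val I]) F (fcons i f).
have split_weight (I : ksubset N r) :
    \sum_i (if i \in val I then 1 else k.+1%:R) * S I i =
    k.+1%:R * (\sum_i S I i) - k%:R * \sum_(i in val I) S I i.
  rewrite [X in _ - _ * X]big_mkcond !mulr_sumr -sumrB; apply: eq_bigr => i _.
  by case: ifP => _; [rewrite -mulrBl -natrB ?leqnSn // subSnn | rewrite mulr0 subr0].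
have sum_in (I : ksubset N r) : \sum_(i in val I) S I i =
    \sum_(f : {ffun 'I_k.+1 -> 'I_N} | [forall a, f a \in val I]) F f.
  rewrite [LHS]big_mkcond [RHS]big_mkcond sum_fcons /=; apply: eq_bigr => i _.
  have into_fcons (f : {ffun 'I_k -> 'I_N}) :
      [forall a, fcons i f a \in val I] =
      (i \in val I) && [forall a, f a \in val I].
    apply/forallP/andP => [fI | [iI /forallP fI] a].
      split; first by have := fI ord0; rewrite fcons0.
      by apply/forallP => a; have := fI (lift ord0 a); rewrite fcons_lift.
    by case: (unliftP ord0 a) => [b ->|->]; rewrite ?fcons_lift ?fcons0.
  under [RHS]eq_bigr do rewrite into_fcons.
  by case: ifP => _ /=; [rewrite /S big_mkcond | rewrite big1].
under eq_bigr => I _ do rewrite split_weight sum_in.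
rewrite big_split /= sumrN -!mulr_sumr sum_supersets // mulrBl !mulrA.
congr (_ - _); rewrite -mulrA; congr (_ * _).
rewrite sum_fcons [X in _ = _ * X]exchange_big /=.
under eq_bigr => I _ do rewrite /S exchange_big /=.
apply: (sum_supersets (F := fun f => \sum_i F (fcons i f))) => // f ninj.
by apply: big1 => i _; apply/F0/fcons_noninj.
Qed.

Lemma vol_zetaE (R : realType) (m n r k : nat) (M : 'M[R]_(m, n)) : (r <= m)%N ->
  vol_zeta r k M = 'C(m - k, m - r)%:R * frobenius_norm (compound k M) ^+ 2.
Proof.
move=> le_rm; apply: (mulfI (_ : k`!%:R ^+ 2 != 0 :> R)).
  by rewrite expf_neq0 // pnatr_eq0 -lt0n fact_gt0.
rewrite mulrCA sqr_frobenius_compound expr2 -mulrA.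
under [X in _ = _ * X]eq_bigr do rewrite sum_sqr_minors_cols.
rewrite -mulr_sumr [RHS]mulrCA; congr (_ * _).
rewrite /vol_zeta [X in _ * X = _]exchange_big [X in _ = _ * X]exchange_big /=.
rewrite [LHS]mulr_sumr [RHS]mulr_sumr; apply: eq_bigr => J _.
rewrite [LHS]mulr_sumr.
under [LHS]eq_bigr do rewrite vol2_minors.
by apply: sum_supersets => // f ninj; rewrite minor_noninj // expr0n.
Qed.

(** A factor [k + 1] arises from the columns too: each set of [k + 1] columns is
    met once for each of its elements in the role of [j]. *)
Lemma sum_vol2_error (R : realType) (m n r k : nat) (M : 'M[R]_(m, n)) :
    (r <= m)%N ->
  \sum_(I : ksubset m r) \sum_(J : ksubset n k)
    vol2 M I J * frobenius_norm (cur M I J - M) ^+ 2 <=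
  (k.+1%:R * 'C(m - k, m - r)%:R - k%:R * 'C(m - k.+1, m - r)%:R) *
    (k.+1%:R * frobenius_norm (compound k.+1 M) ^+ 2).
Proof.
move=> le_rm; have fact_neq0 q : q`!%:R != 0 :> R by rewrite pnatr_eq0 -lt0n fact_gt0.
have fact_pos : 0 < (k.+1)`!%:R :> R by rewrite ltr0n fact_gt0.
rewrite -(ler_pM2l fact_pos) mulr_sumr.
apply: (@le_trans _ _ (\sum_(I : ksubset m r) \sum_(J : ksubset n k)
    \sum_j \sum_i
      (if i \in val I then 1 else k.+1%:R) * sqr_bordered_minors M I J i j)).
  apply: ler_sum => I _; rewrite mulr_sumr; apply: ler_sum => J _; exact: vol2_error.
rewrite exchange_big /=; under eq_bigr do rewrite exchange_big /=.
under eq_bigr => J _.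
  under eq_bigr => j _.
    rewrite (sum_weighted_supersets
      (F := fun f => minor M f (fcons j (finfun (ksubset_idx J))) ^+ 2)) //; last first.
      by move=> f ninj; rewrite minor_noninj // expr0n.
    over.
  rewrite -mulr_sumr.
  over.
rewrite -mulr_sumr mulrCA le_eqVlt; apply/orP; left; apply/eqP; congr (_ * _).
apply: (mulfI (fact_neq0 k)).
have -> (x : R) : k`!%:R * ((k.+1)`!%:R * (k.+1%:R * x)) = (k.+1)`!%:R ^+ 2 * x.
  by rewrite factS natrM; ring.
rewrite sqr_frobenius_compound.
under [RHS]eq_bigr do rewrite sum_sqr_minors_fcons.
rewrite -mulr_sumr; congr (_ * _); rewrite [RHS]exchange_big /=; apply: eq_bigr => J _.
by rewrite exchange_big.
Qed.

Theorem theorem4 (R : realType) (m n k r : nat) (M : 'M[R]_(m, n))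
    (hmn : (n <= m)%N) (hk : (1 <= k)%N) (hkr : (k <= r)%N) (hrm : (r <= m)%N)
    (hkn : (k <= n)%N) (hkm : (k < m)%N) (hC : compound k M != 0) :
  vol_expectation M
    (fun (I : ksubset m r) (J : ksubset n k) =>
       frobenius_norm (cur M I J - M) ^+ 2)
  <= ((m%:R - r%:R) / (m%:R - k%:R) * (k%:R + 1) ^+ 2
      + (r%:R - k%:R) / (m%:R - k%:R) * (k%:R + 1))
     * (frobenius_norm (compound k.+1 M) ^+ 2
        / frobenius_norm (compound k M) ^+ 2).
Proof.
set D := frobenius_norm (compound k.+1 M) ^+ 2.
set C := frobenius_norm (compound k M) ^+ 2.
have C_gt0 : 0 < C.
  rewrite lt_neqAle sqr_ge0 andbT eq_sym; apply: contraNneq hC => C0.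
  move: C0; rewrite /C sqr_frobenius_norm => /eqP.
  rewrite psumr_eq0 => [/allP C0|i _]; last by apply: sumr_ge0 => j _; exact: sqr_ge0.
  apply/eqP/matrixP => i j; rewrite [RHS]mxE; apply/eqP; rewrite -sqrf_eq0.
  have := C0 i (mem_index_enum _); rewrite psumr_eq0 => [/allP/(_ j (mem_index_enum _))//|l _].
  exact: sqr_ge0.
set B : R := 'C(m - k, m - r)%:R.
have B_gt0 : 0 < B by rewrite ltr0n bin_gt0 leq_sub2l.
have mk_gt0 : 0 < m%:R - k%:R :> R by rewrite subr_gt0 ltr_nat.
(* The two counts of sets I differ by the factor (r - k) / (m - k). *)
have B1E : (m%:R - k%:R) * 'C(m - k.+1, m - r)%:R = (r%:R - k%:R) * B.
  rewrite -!natrB ?(ltnW hkm) // -!natrM subnS mul_bin_down.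
  by rewrite subnAC subKn.
have -> : vol_expectation M (fun (I : ksubset m r) (J : ksubset n k) =>
       frobenius_norm (cur M I J - M) ^+ 2) = (B * C)^-1 *
    \sum_(I : ksubset m r) \sum_(J : ksubset n k)
      vol2 M I J * frobenius_norm (cur M I J - M) ^+ 2.
  rewrite /vol_expectation mulr_sumr; apply: eq_bigr => I _.
  rewrite mulr_sumr; apply: eq_bigr => J _.
  by rewrite /vol_prob vol_zetaE // [RHS]mulrA.
apply: (@le_trans _ _ ((B * C)^-1 *
    ((k.+1%:R * B - k%:R * 'C(m - k.+1, m - r)%:R) * (k.+1%:R * D)))).
  apply: ler_wpM2l; first by rewrite invr_ge0; apply/ltW/mulr_gt0.
  exact: sum_vol2_error.
have -> : 'C(m - k.+1, m - r)%:R = (r%:R - k%:R) * B / (m%:R - k%:R).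
  by rewrite -B1E [RHS]mulrC mulKf // gt_eqF.
have ? : B != 0 by rewrite gt_eqF.
have ? : C != 0 by rewrite gt_eqF.
have ? : m%:R - k%:R != 0 :> R by rewrite gt_eqF.
rewrite -natr1 le_eqVlt; apply/orP; left; apply/eqP; field; exact/and3P.
Qed.
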